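(* Let $\Theta_0,\Theta_1\subset\Lambda$, and consider testing $H_0: P\in\Theta_0$ versus $H_1: P\in\Theta_1$. (i) Let $\tau_\Psi$ be any one of the weak topology, the $\tau$-topology, or the $\tau_\Phi$-topology on $\Lambda$, and let $\Theta_0$ be relatively compact in the $\tau_\Psi$-topology. Then there is a consistent sequence of tests if $\Theta_0$ and $\Theta_1$ are contained respectively in a closed set and an $F_\sigma$-set (in the $\tau_\Psi$-topology) that are disjoint. (ii) For the $\tau$-topology, the converse holds if one supposes additionally that $\Theta_1$ is contained in some $\sigma$-compact set: if $\Theta_0$ is relatively compact in the $\tau$-topology, $\Theta_1$ is contained in some set that is $\sigma$-compact in the $\tau$-topology, and there is a consistent sequence of tests, then $\Theta_0$ and $\Theta_1$ are contained respectively in a closed set and an $F_\sigma$-set (in the $\tau$-topology) that are disjoint.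
   Context: $\Omega$ is a topological space with Borel $\sigma$-field $\mathfrak{B}$, and $\Lambda$ is the set of all probability measures on $(\Omega,\mathfrak{B})$. One observes i.i.d. random variables $X_1,\ldots,X_n$ with values in $\Omega$ and distribution $P\in\Lambda$. A test $K_n$ is a measurable function of $(X_1,\ldots,X_n)$ with values in $[0,1]$ (the probability of rejecting the hypothesis). A sequence of tests $K_n$ is consistent if $\lim_{n\to\infty}\sup_{P\in\Theta_0}E_P[K_n]=0$ and $\lim_{n\to\infty}E_Q[1-K_n]=0$ for every $Q\in\Theta_1$. For a set $\Psi$ of measurable functions $f:\Omega\to\mathbb{R}$, the $\tau_\Psi$-topology on $\Lambda$ is the coarsest topology for which all maps $P\mapsto\int_\Omega f\,dP$, $f\in\Psi$, are continuous. If $\Psi$ is the set of all bounded continuous functions this is the weak topology; if $\Psi$ is the set of indicator functions of all Borel sets it is the $\tau$-topology; if $\Psi=\Phi$ is the set of all bounded measurable functions it is the $\tau_\Phi$-topology. An $F_\sigma$-set is a countable union of closed sets; a $\sigma$-compact set is a countable union of compact sets. *)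

(* Defs.v *)
From HB Require Import structures.
From mathcomp Require Import all_boot all_order all_algebra.
From mathcomp Require Import all_classical all_reals all_analysis.
From mathcomp Require Import borel_hierarchy.

Set Implicit Arguments.
Unset Strict Implicit.
Unset Printing Implicit Defensive.

Import Order.TTheory GRing.Theory Num.Theory.
Import numFieldNormedType.Exports.

Local Open Scope classical_set_scope.
Local Open Scope ring_scope.

Section product_power.
Context {d : measure_display} {T : measurableType d} {R : realType}.

Definition tuple_cons n (x : T * n.-tuple T) : n.+1.-tuple T :=
  [tuple of x.1 :: x.2].

Lemma measurable_tuple_cons n : measurable_fun setT (@tuple_cons n).
Proof. exact: measurable_cons. Qed.

HB.instance Definition _ n :=
  isMeasurableFun.Build _ _ _ _ (@tuple_cons n) (@measurable_tuple_cons n).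

(* P^n on the product sigma-algebra of n.-tuple T, by P^0 = the point mass at
   the empty tuple and P^(n+1) = the image of P \x P^n under cons; see
   power_probability_box. *)
Fixpoint power_probability (P : probability T R) n :
    probability (n.-tuple T) R :=
  match n with
  | 0 => dirac [tuple]
  | m.+1 => distribution (P \x power_probability P m)%E (@tuple_cons m)
  end.

Lemma power_probability_box (P : probability T R) n (A : 'I_n -> set T) :
  (forall i, measurable (A i)) ->
  power_probability P n [set x | forall i, A i (tnth x i)] =
  (\prod_(i < n) P (A i))%E.
Proof.
elim: n A => [|n IH] A mA.
  rewrite big_ord0 /= diracE mem_set//; by case.
rewrite big_ord_recl -(IH (fun i => A (lift ord0 i)))//=.
rewrite /distribution /pushforward /=.
have -> : @tuple_cons n @^-1` [set x | forall i, A i (tnth x i)] =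
    A ord0 `*` [set x | forall i, A (lift ord0 i) (tnth x i)].
  apply/seteqP; split=> -[x t] /=.
    move=> H; split; first exact: (H ord0).
    by move=> i; have := H (lift ord0 i); rewrite tnthS.
  move=> [H0 H] i; case: (unliftP ord0 i) => [j ->|->//].
  by rewrite tnthS; exact: H.
rewrite product_measure1E//.
have -> : [set x : n.-tuple T | forall i, A (lift ord0 i) (tnth x i)] =
    \bigcap_(i in [set: 'I_n]) ((fun x => tnth x i) @^-1` A (lift ord0 i)).
  by apply/seteqP; split=> x /= H i => [_|]; exact: H.
apply: fin_bigcap_measurable => // i _; rewrite -[X in measurable X]setTI.
exact: measurable_tnth.
Qed.

End product_power.

Definition borel (Omega : ptopologicalType) : measurableType _ :=
  g_sigma_algebraType (@open Omega).

Definition prob_measures (Omega : ptopologicalType) (R : realType) : choiceType :=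
  probability (borel Omega) R.

Section tau_topology.
Context {Omega : ptopologicalType} {R : realType}.

(* The coarsest topology making every P |-> \int f dP, f in Psi, continuous.
   Elements of [probability] are functions on all subsets of Omega, so distinct
   ones may agree on the Borel sets; this topology does not separate them, and
   it induces the usual one on the quotient. *)
Definition tau (Psi : set (Omega -> R)) : topologicalType :=
  sup_topology (fun f : {f : Omega -> R | Psi f} =>
    Topological.class (initial_topology
      (fun P : prob_measures Omega R => \int[P]_x (sval f x) : R))).

Definition bounded_continuous : set (Omega -> R) :=
  [set f | continuous f /\ bounded_fun f].

Definition borel_indicators : set (Omega -> R) :=
  [set \1_A | A in @measurable _ (borel Omega)].

Definition bounded_borel : set (Omega -> R) :=
  [set f : Omega -> R | measurable_fun [set: borel Omega] f /\ bounded_fun f].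

End tau_topology.

Definition sigma_compact (T : topologicalType) (A : set T) : Prop :=
  exists2 C : (set T)^nat, (forall i, compact (C i)) & A = \bigcup_i C i.

Section tests.
Context {Omega : ptopologicalType} {R : realType}.
Implicit Types (K : forall n, n.-tuple (borel Omega) -> R)
  (Theta : set (prob_measures Omega R)).

Definition is_test n (K : n.-tuple (borel Omega) -> R) : Prop :=
  measurable_fun setT K /\ forall x, 0 <= K x <= 1.

Definition expect n (P : prob_measures Omega R)
    (f : n.-tuple (borel Omega) -> R) : R :=
  \int[power_probability P n]_x f x.

(* [sup set0 = 0], so the first condition is vacuous for empty Theta0. *)
Definition consistent Theta0 Theta1 K : Prop :=
  (fun n => sup [set expect P (K n) | P in Theta0]) @ \oo --> 0 /\
  forall Q, Theta1 Q ->
    (fun n => expect Q (fun x => 1 - K n x)) @ \oo --> 0.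

Definition has_consistent_tests Theta0 Theta1 : Prop :=
  exists K : forall n, n.-tuple (borel Omega) -> R,
    (forall n, is_test (K n)) /\ consistent Theta0 Theta1 K.

Definition closed_Fsigma_separated (Psi : set (Omega -> R)) Theta0 Theta1 : Prop :=
  exists F0 F1 : set (tau Psi),
    [/\ closed F0, Fsigma F1, Theta0 `<=` F0, Theta1 `<=` F1 &
        F0 `&` F1 = set0].

End tests.

(* Main.v *)
Require Import Defs.
From HB Require Import structures.
From mathcomp Require Import all_boot all_order all_algebra.
From mathcomp Require Import all_classical all_reals all_analysis.
From mathcomp Require Import borel_hierarchy.
From mathcomp Require Import measurable_realfun lra.

Set Implicit Arguments.
Unset Strict Implicit.
Unset Printing Implicit Defensive.

Import Order.TTheory GRing.Theory Num.Theory.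
Import numFieldNormedType.Exports.

Local Open Scope classical_set_scope.
Local Open Scope ring_scope.

(** Tests may be taken non-randomized: replacing a test K by the rejection region
{K >= 1/2} at most doubles both error probabilities, by Markov's inequality
([has_consistent_testsP]).

Existence of tests.  If [f] is bounded and measurable, Chebyshev's inequality
for the sample mean of [f] bounds the probability that it strays from the mean
of [f] by a fixed amount by c / n, with a constant c depending only on the
amount and on a bound of [f], hence not on the distribution
([chebyshev_sample_sum]).  So {P : |E_P f - a| < e/2} and
{Q : |E_Q f - a| >= e} can be told apart with errors O(1/n), uniformly on both
sides ([testable_mean]).  Such uniform separability is stable under finite
unions on either side, and finite intersections of sets {P : |E_P f - a| < e}
form a base of the topologies at hand.  Therefore a point outside a closed set [D]
has a neighbourhood separable from [D] ([testable_near]), and a compact set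
disjoint from [D] is separable from [D] ([testable_compact_closed]).  For
countably many closed sets D_k, with errors c_k / n, one rejects when one of
the first tests does, the number of tests used growing slowly enough with n
for the errors of the first kind to sum to o(1)
([consistent_regions_diagonal]).

Necessity.  Let A_n be consistent rejection regions.  The separating sets are
the closure of Theta0, and the union over i of
{Q in closure D_i : Q^n(A_n) >= 1/2 for all n >= i}, where the compact sets D_i
increase to a set containing Theta1.  They have the required properties as soon
as P |-> P^n(A) is tau-continuous on the closure of a compact set, for every
measurable [A] ([within_continuous_power_probability]).  For boxes this is clear,
even on all of Lambda.  On a compact set, Dini's theorem shows that
P(E_j) -> 0 uniformly in P whenever the sets E_j decrease to the empty set.
This uniform countable additivity is inherited by the powers P^n
([uniformly_sigma_additive_power]), and it is what makes continuity pass to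
countable disjoint unions, so that the pi-lambda theorem extends it from boxes
to all measurable sets ([within_continuous_measure]). *)

(** * Local properties on compact sets *)

(** The sets S such that [Q] holds of C \ S form a filter.  If [Q C] failed, this
filter would be proper and contain [C], but it could not cluster at a point of
[C], because the complement of a neighbourhood satisfying [Q] belongs to it. *)
Lemma compact_local_ind (X : topologicalType) (Q : set X -> Prop) (C : set X) :
  Q set0 -> (forall A B, A `<=` B -> Q B -> Q A) ->
  (forall A B, Q A -> Q B -> Q (A `|` B)) ->
  compact C -> (forall x, C x -> exists2 U, nbhs x U & Q U) -> Q C.
Proof.
move=> Q0 Qsub QU cC Qloc; apply: contrapT => nQC.
pose F : set_system X := [set S | Q (C `\` S)].
have FF : ProperFilter F.
  apply: Build_ProperFilter_ex.
    move=> S /= QS; apply: contrapT => nS; apply: nQC; apply: Qsub QS => x Cx.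
    by split=> // Sx; apply: nS; exists x.
  split; rewrite /F /=.
  - by rewrite setDT.
  - move=> A B QA QB; apply: Qsub (QU _ _ QA QB) => x [Cx /not_andP].
    by move=> [nAx|nBx]; [left|right].
  - by move=> A B AB; apply: Qsub; exact: setDS.
have FC : F C by rewrite /F /= setDv.
have [x [Cx xF]] := cC F FF FC.
have [U xU QU'] := Qloc x Cx.
have FU : F (~` U) by apply: Qsub QU' => y [_ /contrapT].
by have [y []] := xF _ _ FU xU.
Qed.

(** * Integrals of bounded functions *)

(** Bounded measurable functions are integrable for every probability and closed
under the operations needed below, so all integrals can be taken in [R]
instead of the extended reals. *)
Definition bounded_measurable d (T : measurableType d) (R : realType)
    (f : T -> R) : Prop :=
  measurable_fun setT f /\ exists M, forall x, `|f x| <= M.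

Section bounded_measurable_theory.
Context {d} {T : measurableType d} {R : realType}.
Implicit Types f g : T -> R.

Lemma bounded_measurable_cst c : bounded_measurable (cst c : T -> R).
Proof. by split; [exact: measurable_cst|exists `|c|]. Qed.

Lemma bounded_measurableD f g : bounded_measurable f -> bounded_measurable g ->
  bounded_measurable (fun x => f x + g x).
Proof.
move=> [mf [M fM]] [mg [N gN]]; split; first exact: measurable_funD.
by exists (M + N) => x; rewrite (le_trans (ler_normD _ _))// lerD.
Qed.

Lemma bounded_measurableM f g : bounded_measurable f -> bounded_measurable g ->
  bounded_measurable (fun x => f x * g x).
Proof.
move=> [mf [M fM]] [mg [N gN]]; split; first exact: measurable_funM.
by exists (M * N) => x; rewrite normrM ler_pM.
Qed.

Lemma bounded_measurable_indic (A : set T) : measurable A ->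
  bounded_measurable (\1_A : T -> R).
Proof.
move=> mA; split; first exact: measurable_indic.
by exists 1 => x; rewrite indicE; case: (_ \in _); rewrite /= ?normr1 ?normr0.
Qed.

Lemma bounded_measurable_integrable (mu : probability T R) f :
  bounded_measurable f -> mu.-integrable setT (EFin \o f).
Proof.
move=> [mf [M fM]]; apply: measurable_bounded_integrable => //.
  by rewrite (le_lt_trans (probability_le1 _ _) (ltry _)).
exists M; split; first exact: num_real.
by move=> x Mx t _; rewrite /= (le_trans (fM t))// ltW.
Qed.

End bounded_measurable_theory.

Lemma bounded_measurable_comp d1 d2 (T1 : measurableType d1)
    (T2 : measurableType d2) (R : realType) (f : T2 -> R) (h : T1 -> T2) :
  measurable_fun setT h -> bounded_measurable f -> bounded_measurable (f \o h).
Proof.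
move=> mh [mf [M fM]]; split; first exact: measurableT_comp.
by exists M => x; exact: fM.
Qed.

Lemma Rintegral_probability_cst d (T : measurableType d) (R : realType)
    (mu : probability T R) (c : R) : \int[mu]_x c = c.
Proof. by rewrite Rintegral_cst// [X in _ * fine X]probability_setT mulr1. Qed.

Lemma bounded_measurable_01 d (T : measurableType d) (R : realType)
    (f : T -> R) : measurable_fun setT f -> (forall x, 0 <= f x <= 1) ->
  bounded_measurable f.
Proof.
move=> mf f01; split=> //; exists 1 => x.
by have /andP[f0 f1] := f01 x; rewrite ger0_norm.
Qed.

Lemma Rintegral_indic d (T : measurableType d) (R : realType)
    (mu : probability T R) (A : set T) :
  measurable A -> \int[mu]_x \1_A x = fine (mu A).
Proof. by move=> mA; rewrite /Rintegral integral_indic// setIT. Qed.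

(** * Evaluation maps *)

Lemma continuous_tau (Omega : ptopologicalType) (R : realType)
    (Psi : set (Omega -> R)) (f : Omega -> R) :
  Psi f -> continuous (fun P : tau Psi => \int[P]_x f x : R).
Proof.
move=> Pf P.
have /cvg_sup/(_ (exist _ f Pf)) PP : nbhs P --> (P : tau Psi) by exact: cvg_id.
move=> U fPU.
exact: (PP _ (@initial_continuous _ _
  (fun P : prob_measures Omega R => \int[P]_x f x : R) P U fPU)).
Qed.

Lemma continuous_tau_measure (Omega : ptopologicalType) (R : realType)
    (A : set (borel Omega)) : measurable A ->
  continuous (fun P : tau (@borel_indicators Omega R) =>
    fine ((P : prob_measures Omega R) A)).
Proof.
move=> mA.
have -> : (fun P : tau (@borel_indicators Omega R) =>
      fine ((P : prob_measures Omega R) A)) =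
    (fun P : tau (@borel_indicators Omega R) => \int[P]_x \1_A x : R).
  by apply/funext => P; rewrite /Rintegral integral_indic// setIT.
by apply: continuous_tau; exists A.
Qed.

(** * Uniform countable additivity on compact sets *)

(** Countable additivity enters through continuity from above at the empty set,
the form in which Dini's theorem makes it uniform. *)
Definition uniformly_sigma_additive d (T : measurableType d) (R : realType)
    (I : Type) (D : set I) (m : I -> probability T R) : Prop :=
  forall E : (set T)^nat, (forall j, measurable (E j)) ->
    nonincreasing_seq E -> \bigcap_j E j = set0 ->
  forall e : R, 0 < e -> exists j, forall i, D i -> (m i (E j) <= e%:E)%E.

(** Induction on [n].  For E_j decreasing to the empty set, let N_j be the set of
x for which some [m i] gives the section of E_j at x an [n]-th power mass above
e/2.  The induction hypothesis, applied to the sections at each x, says that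
N_j decreases to the empty set, so that m_i(N_j) <= e/2 for all i and some j.
Splitting the integral of the section masses along N_j then gives the bound e.
Countability of the family makes N_j measurable, being a countable union. *)
Lemma uniformly_sigma_additive_power_seq d (T : measurableType d) (R : realType)
    (m : nat -> probability T R) : uniformly_sigma_additive setT m ->
  forall n, uniformly_sigma_additive setT (fun i => power_probability (m i) n).
Proof.
move=> um; elim=> [|n IH] E mE dE E0 e e0.
  have : ~ (\bigcap_j E j) [tuple] by rewrite E0.
  move=> /existsNP[j /not_implyP[_ nEj]]; exists j => _ _ /=.
  by rewrite diracE memNset// lee_fin ltW.
pose E' j := @tuple_cons d T n @^-1` E j.
have mE' j : measurable (E' j).
  by rewrite -[X in measurable X]setTI; exact: measurable_tuple_cons.
have mxE' j x : measurable (xsection (E' j) x) by exact: measurable_xsection.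
pose N j := \bigcup_i [set x |
  ((e / 2)%:E < power_probability (m i) n (xsection (E' j) x))%E].
have mN j : measurable (N j).
  apply: bigcupT_measurable => i; rewrite -[X in measurable X]setTI.
  by apply: measurable_lte => //; exact: measurable_fun_xsection.
have e20 : 0 < e / 2 by lra.
have dE' x j k : (j <= k)%N -> xsection (E' k) x `<=` xsection (E' j) x.
  move=> jk; apply: le_xsection => y; move/dE: jk => /subsetPset; exact.
have [j Hj] : exists j, forall i, [set: nat] i -> (m i (N j) <= (e / 2)%:E)%E.
  apply: um => //.
    move=> j k jk; apply/subsetPset => x [i _ /= ix]; exists i => //=.
    by apply: lt_le_trans ix _; apply: le_measure; rewrite ?inE//; exact: dE'.
  apply/seteqP; split => // x Nx.
  have [j Hj] : exists j, forall i, [set: nat] i ->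
      (power_probability (m i) n (xsection (E' j) x) <= (e / 2)%:E)%E.
    apply: (IH (fun j => xsection (E' j) x)) => //.
      by move=> j k jk; apply/subsetPset; exact: dE'.
    apply/seteqP; split => // t Et.
    suff : (\bigcap_j E j) (tuple_cons (x, t)) by rewrite E0.
    by move=> j _; have /xsectionP := Et j I.
  by have [i _ /= ] := Nx j I; rewrite ltNge Hj//.
exists j => i _.
have -> : power_probability (m i) n.+1 (E j) =
    (\int[m i]_x power_probability (m i) n (xsection (E' j) x))%E by [].
apply: (@le_trans _ _ (\int[m i]_x ((\1_(N j) x)%:E + (e / 2)%:E))%E).
  apply: ge0_le_integral => //.
  - exact: measurable_fun_xsection.
  - apply: emeasurable_funD => //; apply/measurable_EFinP.
    exact: measurable_indic.
  - move=> x _; rewrite indicE; have [xN|/negP xN] := boolP (x \in N j).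
      apply: le_trans (probability_le1 _ _) _ => //.
      by rewrite -EFinD lee_fin lerDl ltW.
    rewrite add0e leNgt; apply/negP => xi; apply: xN.
    by rewrite inE; exists i.
rewrite ge0_integralD//; last 2 first.
- by apply/measurable_EFinP; exact: measurable_indic.
- by move=> x _; rewrite lee_fin ltW.
rewrite integral_indic// setIT integral_cst// [X in (_ * X)%E]probability_setT mule1.
by rewrite (le_trans (leeD2r _ (Hj i I)))// -EFinD lee_fin -splitr.
Qed.

(** A family violating the conclusion contains a sequence violating it: choose,
for each j, a member giving E_j too much mass. *)
Lemma uniformly_sigma_additive_power d (T : measurableType d) (R : realType)
    (I : Type) (D : set I) (m : I -> probability T R) :
  uniformly_sigma_additive D m ->
  forall n, uniformly_sigma_additive D (fun i => power_probability (m i) n).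
Proof.
move=> um n E mE dE E0 e e0; apply: contrapT => /forallNP nE.
have /choice[s sE] : forall j, exists i,
    D i /\ ~ (power_probability (m i) n (E j) <= e%:E)%E.
  by move=> j; have /existsNP[i /not_implyP[Di Ei]] := nE j; exists i.
have [|j Ej] :=
    @uniformly_sigma_additive_power_seq _ _ _ (m \o s) _ n E mE dE E0 e e0.
  move=> F mF dF F0 r r0; have [k Fk] := um F mF dF F0 r r0.
  by exists k => i _; apply: Fk; case: (sE i).
by case: (sE j) => _; apply; exact: Ej.
Qed.

(** Dini's theorem: P |-> P(E_j) is a sequence of continuous functions decreasing
pointwise to 0, hence uniformly so on the compact set.  The bound P(E_j) <= e
is a closed condition and persists on the closure; the topology is not
separated, so a compact set need not be closed. *)
Lemma uniformly_sigma_additive_closure_compact (Omega : ptopologicalType)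
    (R : realType) (C : set (tau (@borel_indicators Omega R))) :
  compact C -> uniformly_sigma_additive (closure C)
    (id : prob_measures Omega R -> probability (borel Omega) R).
Proof.
move=> cC E mE dE E0 e e0.
pose small j : set (tau (@borel_indicators Omega R)) :=
  [set P | ((P : prob_measures Omega R) (E j) <= e%:E)%E].
have smallE j : small j =
    (fun P : tau (@borel_indicators Omega R) =>
      fine ((P : prob_measures Omega R) (E j))) @^-1` [set x | x <= e].
  by apply/seteqP; split => P /=; rewrite -lee_fin fineK// fin_num_measure.
have dsmall j k : (j <= k)%N -> small j `<=` small k.
  move=> jk P; apply: le_trans; apply: le_measure; rewrite ?inE//.
  by move/dE: jk => /subsetPset.
have [j Cj] : exists j, C `<=` small j.
  apply: (@compact_local_ind _ (fun A => exists j, A `<=` small j) C _ _ _ cC).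
  - by exists 0%N.
  - by move=> A B AB [j Bj]; exists j; exact: subset_trans Bj.
  - move=> A B [j Aj] [k Bk]; exists (maxn j k) => P [/Aj|/Bk].
      by apply: dsmall; exact: leq_maxl.
    by apply: dsmall; exact: leq_maxr.
  - move=> P CP.
    have PE : (P : prob_measures Omega R) (E j) @[j --> \oo] --> (0 : R)%:E.
      have := @nonincreasing_cvg_mu _ _ _ (P : prob_measures Omega R) E.
      rewrite E0 measure0; apply => //.
      exact: (le_lt_trans (probability_le1 _ (mE 0%N)) (ltry _)).
    have [j _ Pj] : \forall j \near \oo, fine ((P : prob_measures Omega R) (E j)) < e.
      have /fine_cvgP[_ /cvgrPdist_lt/(_ e e0)] := PE.
      apply: filterS => j; rewrite sub0r normrN /=; exact: le_lt_trans (ler_norm _).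
    exists (small j); last by exists j.
    have ne : nbhs (fine ((P : prob_measures Omega R) (E j))) [set x | x < e].
      by apply: open_nbhs_nbhs; split; [exact: open_lt|exact: (Pj j (leqnn _))].
    have : nbhs (P : tau (@borel_indicators Omega R)) [set Q |
      fine ((Q : prob_measures Omega R) (E j)) < e] := continuous_tau_measure (mE j) ne.
    by rewrite smallE; apply: filterS => Q /ltW.
exists j => P CP; have : closure (small j) P by exact: closureS CP.
have /closure_id <- // : closed (small j).
rewrite smallE; apply: (continuous_closedP _).1; last exact: closed_le.
exact: continuous_tau_measure.
Qed.

(** * Continuity of product powers *)

(** Among the operations of the pi-lambda theorem only the countable disjoint
union is an issue.  There the measure of the union is the sum of a continuous
finite sum and of the mass of a tail, and the tails decrease to the empty set,
so that they are uniformly small: a uniform limit of continuous functions is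
continuous. *)
Lemma within_continuous_measure d (T : measurableType d) (R : realType)
    (X : topologicalType) (D : set X) (m : X -> probability T R)
    (G : set (set T)) :
  @measurable _ T = <<s G >> -> setI_closed G -> uniformly_sigma_additive D m ->
  (forall A, G A -> {within D, continuous (fun x => fine (m x A))}) ->
  forall A, measurable A -> {within D, continuous (fun x => fine (m x A))}.
Proof.
move=> GE GI um Gc; rewrite GE.
have fm x B : measurable B -> m x B \is a fin_num by move=> ?; exact: fin_num_measure.
apply: (@dynkin_induction _ _ _
  (fun A => {within D, continuous (fun x => fine (m x A))}) GE GI) => //.
- rewrite (_ : (fun=> _) = cst (1 : R)); first exact: cst_continuous.
  by apply/funext => x; rewrite [X in fine X]probability_setT.
- move=> B mB Bc; rewrite (_ : (fun=> _) = (fun x => 1 - fine (m x B))).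
    by move=> x; apply: cvgB; [exact: cvg_cst|exact: Bc].
  by apply/funext => x; rewrite probability_setC// fineB// fm.
move=> F mF tF Fc; apply/subspace_continuousP => x Dx.
apply/cvgrPdist_le => e e0.
pose E j := \bigcup_(k in [set k | (j <= k)%N]) F k.
have mE j : measurable (E j) by exact: bigcup_measurable.
have [j Ej] : exists j, forall y, D y -> (m y (E j) <= (e / 3)%:E)%E.
  apply: um => //; last by rewrite divr_gt0.
    move=> i j ij; apply/subsetPset => t [k jk Fkt]; exists k => //=.
    exact: leq_trans jk.
  apply/seteqP; split => // t Et.
  have [k _ Fkt] := Et 0%N I; have [l /= kl Flt] := Et k.+1 I.
  by move: kl; rewrite (tF k l I I) ?ltnn//; exists t.
have mFE y : fine (m y (\bigcup_k F k)) =
    \sum_(k < j) fine (m y (F k)) + fine (m y (E j)).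
  have -> : \bigcup_k F k = \big[setU/set0]_(k < j) F k `|` E j.
    rewrite -bigcup_mkord; apply/seteqP; split => [t [k _ Fkt]|t [|][k _ Fkt]];
      [|by exists k..].
    by have [kj|jk] := ltnP k j; [left|right]; exists k.
  rewrite measureU//; last 2 first.
  - by apply: bigsetU_measurable.
  - rewrite -bigcup_mkord; apply/seteqP; split => // t [[k /= kj Fkt] [l /= jl Flt]].
    have := leq_trans kj jl; rewrite (tF k l I I) ?ltnn//; exists t => //.
  rewrite fineD ?fm//; last exact: bigsetU_measurable.
  rewrite measure_semi_additive_ord//; last exact: bigsetU_measurable.
    by rewrite sum_fine// => k _; rewrite fm.
  by move=> k l _ _ kl; apply/val_inj; apply: tF.
have sc : (fun y => \sum_(k < j) fine (m y (F k))) @ within D (nbhs x) -->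
    \sum_(k < j) fine (m x (F k)).
  apply: cvg_big => [|k _]; first exact: add_continuous.
  by have /subspace_continuousP := Fc k; apply.
have /cvgrPdist_le/(_ (e / 3)) := sc.
rewrite divr_gt0// => /(_ isT); rewrite !near_withinE.
apply: filterS => y + Dy => /(_ Dy); rewrite /from_subspace /= !mFE.
have small y' : D y' -> 0 <= fine (m y' (E j)) <= e / 3.
  by move=> Dy'; rewrite fine_ge0//= -lee_fin fineK ?Ej// fm.
move: (small x Dx) (small y Dy); rewrite !ler_norml.
move: (fine (m x (E j))) (fine (m y (E j))) (\sum_(k < j) _) (\sum_(k < j) _).
move=> a b a' b'; lra.
Qed.



Section boxes.
Context {d : measure_display} {T : measurableType d} (n : nat).

Definition box (A : 'I_n -> set T) : set (n.-tuple T) :=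
  [set x | forall i, A i (tnth x i)].

Definition measurable_boxes : set (set (n.-tuple T)) :=
  [set box A | A in [set A | forall i, measurable (A i)]].

Lemma measurable_box A : (forall i, measurable (A i)) -> measurable (box A).
Proof.
move=> mA.
have -> : box A = \bigcap_(i in [set: 'I_n]) ((fun x => tnth x i) @^-1` A i).
  by apply/seteqP; split=> x /= H i => [_|]; exact: H.
apply: fin_bigcap_measurable => // i _; rewrite -[X in measurable X]setTI.
exact: measurable_tnth.
Qed.

Lemma measurable_tuple_boxes :
  @measurable _ (n.-tuple T) = <<s measurable_boxes >>.
Proof.
apply/seteqP; split; last first.
  apply: smallest_sub; first exact: sigma_algebra_measurable.
  by move=> _ [A mA <-]; exact: measurable_box.
apply: smallest_sub; first exact: smallest_sigma_algebra.
rewrite -bigcup_seq => _ [i _ [B mB <-]]; apply: sub_sigma_algebra.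
exists (fun j => if j == i then B else setT); first by move=> j /=; case: ifP.
apply/seteqP; split=> [x /(_ i)|x [_ Bx] j /=]; first by rewrite eqxx.
by case: eqP => // ->.
Qed.

Lemma setI_closed_boxes : setI_closed measurable_boxes.
Proof.
move=> _ _ [A mA <-] [B mB <-]; exists (fun i => A i `&` B i).
  by move=> i; exact: measurableI.
apply/seteqP; split=> [x AB|x [Ax Bx] i]; last by split.
by split=> i; case: (AB i).
Qed.

End boxes.

(** The mass of a box under the [n]-th power of P is P(B_1) * ... * P(B_n), a
continuous function of P, and the boxes form a pi-system generating the product
sigma-algebra. *)
Lemma within_continuous_power_probability (Omega : ptopologicalType)
    (R : realType) (D : set (tau (@borel_indicators Omega R))) (n : nat)
    (A : set (n.-tuple (borel Omega))) :
  uniformly_sigma_additive D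
    (id : prob_measures Omega R -> probability (borel Omega) R) ->
  measurable A ->
  {within D, continuous (fun P : tau (@borel_indicators Omega R) =>
    fine (power_probability (P : prob_measures Omega R) n A))}.
Proof.
move=> uD mA.
have := @within_continuous_measure _ (n.-tuple (borel Omega)) R
  (tau (@borel_indicators Omega R)) D
  (fun P => power_probability (P : prob_measures Omega R) n)
  (@measurable_boxes _ (borel Omega) n) (@measurable_tuple_boxes _ _ n)
  (@setI_closed_boxes _ _ n).
apply => //; first exact: uniformly_sigma_additive_power.
move=> _ [B mB <-]; apply: continuous_subspaceT.
have -> : (fun P : tau (@borel_indicators Omega R) =>
      fine (power_probability (P : prob_measures Omega R) n (box B))) =
    (fun P : tau (@borel_indicators Omega R) =>
    \prod_(i < n) fine ((P : prob_measures Omega R) (B i))).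
  apply/funext => P; rewrite power_probability_box//.
  rewrite (eq_bigr (fun i => (fine ((P : prob_measures Omega R) (B i)))%:E)).
    by rewrite prodEFin.
  by move=> i _; rewrite fineK// fin_num_measure.
apply: continuous_big => [|i _]; first exact: mul_continuous.
exact: continuous_tau_measure.
Qed.

(** * Rejection regions *)

Lemma markov_half d (T : measurableType d) (R : realType)
    (mu : probability T R) (f : T -> R) (A : set T) :
  measurable_fun setT f -> (forall x, 0 <= f x <= 1) -> measurable A ->
  (forall x, A x -> 1 / 2 <= f x) -> fine (mu A) <= 2 * \int[mu]_x f x.
Proof.
move=> mf f01 mA Af; rewrite -Rintegral_indic// -ler_pdivrMl//.
have bA := @bounded_measurable_indic _ _ R A mA.
rewrite -RintegralZl//; last exact: bounded_measurable_integrable.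
apply: le_Rintegral => //.
- apply: bounded_measurable_integrable.
  by apply: bounded_measurableM => //; exact: bounded_measurable_cst.
- by apply: bounded_measurable_integrable; exact: bounded_measurable_01.
- move=> x _; rewrite indicE; have := f01 x.
  by have [/set_mem/Af|_] /= := boolP (x \in A); lra.
Qed.

Lemma Rintegral_le1 d (T : measurableType d) (R : realType)
    (mu : probability T R) (f : T -> R) :
  measurable_fun setT f -> (forall x, 0 <= f x <= 1) -> \int[mu]_x f x <= 1.
Proof.
move=> mf f01; rewrite -[leRHS](Rintegral_probability_cst mu).
apply: le_Rintegral => //.
- by apply: bounded_measurable_integrable; exact: bounded_measurable_01.
- exact/bounded_measurable_integrable/bounded_measurable_cst.
- by move=> x _; case/andP: (f01 x).
Qed.

Section rejection_regions.
Context {Omega : ptopologicalType} {R : realType}.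
Implicit Types Theta : set (prob_measures Omega R).

(** Consistency of the non-randomized tests with rejection regions [A n].  Bounding
the error of the first kind by a null sequence, rather than taking a supremum
over [Theta0], turns it into pointwise conditions, which continuity carries
over to the closure of [Theta0]. *)
Definition consistent_regions Theta0 Theta1
    (A : forall n, set (n.-tuple (borel Omega))) : Prop :=
  [/\ forall n, measurable (A n),
      exists2 a : nat -> R, a @ \oo --> 0 & forall n P, Theta0 P ->
        fine (power_probability (P : prob_measures Omega R) n (A n)) <= a n &
      forall Q, Theta1 Q ->
        fine (power_probability (Q : prob_measures Omega R) n (~` A n))
          @[n --> \oo] --> 0].

Lemma has_consistent_testsP Theta0 Theta1 :
  has_consistent_tests Theta0 Theta1 <->
  exists A, consistent_regions Theta0 Theta1 A.
Proof.
split=> [[K [tK [K0 K1]]]|[A [mA [a a0 Aa] A1]]].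
  pose A n : set (n.-tuple (borel Omega)) := [set x | 1 / 2 <= K n x].
  have mA n : measurable (A n).
    rewrite /A -[X in measurable X]setTI.
    by apply: measurable_fun_le => //; case: (tK n).
  exists A; split => //.
    exists (fun n => 2 * sup [set expect P (K n) | P in Theta0]).
      by rewrite -(mulr0 2); apply: cvgM => //; exact: cvg_cst.
    move=> n P P0; have [mK K01] := tK n.
    apply: le_trans (markov_half _ mK K01 (mA n) _) _ => //.
    rewrite ler_pM2l//; apply: ub_le_sup; last by exists P.
    by exists 1 => _ [Q _ <-]; exact: Rintegral_le1.
  move=> Q Q1; have := K1 Q Q1 => /(cvgM (cvg_cst (2 : R))); rewrite mulr0 => Q0.
  apply: (squeeze_cvgr _ (cvg_cst 0) Q0); apply: nearW => n /=.
  rewrite fine_ge0//=; have [mK K01] := tK n.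
  apply: markov_half.
  - by apply: measurable_funB.
  - by move=> x; have := K01 x; lra.
  - by apply: measurableC; exact: mA.
  - by move=> x /negP; rewrite /A /= -ltNge; lra.
exists (fun n => \1_(A n)); split => [n|].
  split=> [|x]; first by apply: measurable_indic; exact: mA.
  by rewrite indicE; case: (_ \in _); rewrite /= ?lexx ?ler01.
have eA n (P : prob_measures Omega R) : expect P (\1_(A n) : _ -> R) =
    fine (power_probability P n (A n)) by apply: Rintegral_indic; exact: mA.
split=> [|Q Q1]; last first.
  rewrite (_ : (fun n => _) = fun n =>
    fine (power_probability (Q : prob_measures Omega R) n (~` A n))).
    exact: A1.
  apply/funext => n; rewrite -Rintegral_indic; last by apply: measurableC; exact: mA.
  apply: eq_Rintegral => x _; rewrite !indicE in_setC.
  by case: (_ \in _); rewrite /= ?subrr ?subr0.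
have [->|/set0P[P0 TP0]] := eqVneq Theta0 set0.
  rewrite (_ : (fun n => _) = cst 0); first exact: cvg_cst.
  by apply/funext => n; rewrite image_set0 sup0.
apply: (squeeze_cvgr _ (cvg_cst 0) a0); apply: nearW => n /=.
have mAn := mA n; apply/andP; split.
  apply: (@le_trans _ _ (expect P0 (\1_(A n)))); first by rewrite eA fine_ge0.
  apply: ub_le_sup; last by exists P0.
  by exists (a n) => _ [Q Q0 <-]; rewrite eA Aa.
apply: ge_sup; first by exists (expect P0 (\1_(A n))); exists P0.
by move=> _ [P TP <-]; rewrite eA Aa.
Qed.

End rejection_regions.

(** * Separating the hypotheses from consistent regions *)

Lemma closed_within_preimage (X Y : topologicalType) (D : set X) (f : X -> Y)
    (B : set Y) : closed D -> {within D, continuous f} -> closed B ->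
  closed (D `&` f @^-1` B).
Proof.
move=> cD cf cB; rewrite (@closed_setSI _ _ (f @^-1` B))//.
exact: ((continuous_closedP _).1 cf).
Qed.

Section regions_separate.
Context {Omega : ptopologicalType} {R : realType}.
Let Lambda := tau (@borel_indicators Omega R).
Let power n (A : set (n.-tuple (borel Omega))) (P : Lambda) : R :=
  fine (power_probability (P : prob_measures Omega R) n A).

(** On the closure of [Theta0] the probability of rejection still tends to 0,
since the bound [a n] is a closed condition there; in the F_sigma-set it stays
at least 1/2 for all large [n].  Hence the two sets are disjoint. *)
Lemma consistent_regions_separated (Theta0 Theta1 : set Lambda) A :
  consistent_regions Theta0 Theta1 A -> precompact Theta0 ->
  (exists2 S : set Lambda, sigma_compact S & Theta1 `<=` S) ->
  closed_Fsigma_separated (@borel_indicators Omega R) Theta0 Theta1.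
Proof.
move=> [mA [a a0 Aa] A1]; rewrite precompactE => c0 [_ [C cC ->] Theta1C].
have closed_power (K D : set Lambda) n (B : set R) : compact K ->
    D = closure K -> closed B -> closed (D `&` power (A n) @^-1` B).
  move=> cK -> cB; apply: closed_within_preimage => //.
    exact: closed_closure.
  apply: within_continuous_power_probability => //.
  exact: uniformly_sigma_additive_closure_compact.
(* one index serves both for the compact sets and for the sample size from which
   the bound is required: both conditions weaken as it grows *)
pose D i := closure (\big[setU/set0]_(k < i.+1) C k).
pose F1 i := D i `&` [set Q | forall n, (i <= n)%N -> 1 / 2 <= power (A n) Q].
exists (closure Theta0), (\bigcup_i F1 i); split.
- exact: closed_closure.
- exists F1 => // i.
  have -> : F1 i = \bigcap_(n in [set n | (i <= n)%N])
      (D i `&` power (A n) @^-1` [set x | 1 / 2 <= x]).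
    apply/seteqP; split=> [Q [DQ iQ] n /iQ//|Q H].
    split=> [|n /H[]//]; by case: (H i (leqnn i)).
  apply: closed_bigI => n _; apply: closed_power (erefl _) _.
    by apply: bigsetU_compact => k _; exact: cC.
  exact: closed_ge.
- exact: (@subset_closure Lambda Theta0).
- move=> Q Q1; have [k _ CQ] := Theta1C Q Q1.
  have /cvgrPdist_lt/(_ (1 / 2)) := A1 Q Q1.
  rewrite divr_gt0// => /(_ isT)[m _ mQ].
  exists (maxn k m) => //; split.
    apply: subset_closure; rewrite -bigcup_mkord; exists k => //=.
    by rewrite ltnS leq_maxl.
  move=> n /= kmn; have := mQ n (leq_trans (leq_maxr _ _) kmn).
  rewrite sub0r normrN ger0_norm ?fine_ge0// /power.
  have mAn := mA n; rewrite probability_setC// fineB ?fin_num_measure//=.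
  lra.
- rewrite -subset0 => P [P0 [i _ [_ iP]]].
  have Pa n : power (A n) P <= a n.
    have clE : closure Theta0 = closure (closure Theta0 : set Lambda).
      exact/closure_id/closed_closure.
    have /closure_id cl := closed_power _ _ n _ c0 clE (@closed_le _ (a n)).
    suff : (closure Theta0 `&` power (A n) @^-1` [set x | x <= a n]) P by case.
    rewrite cl; apply: closureS P0 => Q Q0.
    by split; [exact: (@subset_closure Lambda Theta0)|exact: Aa].
  have /cvgrPdist_lt/(_ (1 / 2)) := a0.
  rewrite divr_gt0// => /(_ isT)[m _ ma].
  have := ma (maxn i m) (leq_maxr _ _); have := iP (maxn i m) (leq_maxl _ _).
  have := Pa (maxn i m); rewrite sub0r normrN => Pm im /(le_lt_trans (ler_norm _)).
  lra.
Qed.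
End regions_separate.

(** * A quantitative law of large numbers *)

Section sample_sums.
Context {d} {T : measurableType d} {R : realType} (P : probability T R).

(** Fubini's theorem, conditioning on the first observation. *)
Lemma Rintegral_power_probabilityS n (F : n.+1.-tuple T -> R) :
  bounded_measurable F ->
  \int[power_probability P n.+1]_x F x =
  \int[P]_x \int[power_probability P n]_t F (tuple_cons (x, t)).
Proof.
move=> bF; have bFc := bounded_measurable_comp (@measurable_tuple_cons _ T n) bF.
have bFx x : bounded_measurable (fun t => F (tuple_cons (x, t))).
  exact: (bounded_measurable_comp (measurable_pair1 x) bFc).
rewrite /Rintegral [X in fine X](_ : _ =
    \int[(P \x power_probability P n)%E]_z (F (tuple_cons z))%:E)%E.
  rewrite -integral12_prod_meas1/=; last first.
    exact: (@bounded_measurable_integrable _ _ _ (P \x power_probability P n)%E).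
  congr fine; apply: eq_integral => x _; rewrite /fubini_F fineK//.
  by apply: integrable_fin_num => //; exact: bounded_measurable_integrable.
rewrite /= /distribution integral_pushforward//.
- by case: bF => mF _; apply/measurable_EFinP.
- exact: (@bounded_measurable_integrable _ _ _ (P \x power_probability P n)%E).
Qed.

Definition sample_sum (g : T -> R) n (x : n.-tuple T) : R :=
  \sum_(i < n) g (tnth x i).

Lemma sample_sum_cons g n x (t : n.-tuple T) :
  sample_sum g (tuple_cons (x, t)) = g x + sample_sum g t.
Proof.
rewrite /sample_sum big_ord_recl tnth0; congr (_ + _).
by apply: eq_bigr => i _; rewrite tnthS.
Qed.

Lemma bounded_measurable_sample_sum g n : bounded_measurable g ->
  bounded_measurable (@sample_sum g n).
Proof.
move=> [mg [M gM]]; split.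
  apply: measurable_sum => i; apply: measurableT_comp => //.
  exact: measurable_tnth.
exists (\sum_(i < n) M) => x; rewrite (le_trans (ler_norm_sum _ _ _))//.
by apply: ler_sum => i _; exact: gM.
Qed.

Lemma Rintegral_sample_sum g n : bounded_measurable g -> \int[P]_x g x = 0 ->
  \int[power_probability P n]_x sample_sum g x = 0.
Proof.
move=> bg g0; elim: n => [|n IH].
  rewrite (@eq_Rintegral _ _ _ _ _ (cst 0)); first exact: Rintegral_probability_cst.
  by move=> x _; rewrite /sample_sum big_ord0.
have bS := bounded_measurable_sample_sum n bg.
rewrite Rintegral_power_probabilityS; last exact: bounded_measurable_sample_sum.
rewrite (@eq_Rintegral _ _ _ _ _ g)// => x _.
under eq_Rintegral do rewrite sample_sum_cons.
rewrite RintegralD//; last 2 first.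
- exact/bounded_measurable_integrable/bounded_measurable_cst.
- exact: bounded_measurable_integrable.
by rewrite IH addr0 Rintegral_probability_cst.
Qed.

(** Expanding the square of the first term plus the remaining sum, the cross term
has integral zero, since the remaining sum is centred. *)
Lemma Rintegral_sample_sum_sqr g n : bounded_measurable g ->
  \int[P]_x g x = 0 ->
  \int[power_probability P n]_x (sample_sum g x) ^+ 2 =
  n%:R * \int[P]_x (g x) ^+ 2.
Proof.
move=> bg g0; elim: n => [|n IH].
  rewrite (@eq_Rintegral _ _ _ _ _ (cst 0)).
    by rewrite mul0r; exact: Rintegral_probability_cst.
  by move=> x _; rewrite /sample_sum big_ord0 expr0n.
have bg2 : bounded_measurable (fun x => (g x) ^+ 2).
  exact: bounded_measurableM.
have bS := bounded_measurable_sample_sum n bg.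
have bS2 : bounded_measurable (fun t : n.-tuple T => (sample_sum g t) ^+ 2).
  exact: bounded_measurableM.
rewrite Rintegral_power_probabilityS; last first.
  by apply: bounded_measurableM; exact: bounded_measurable_sample_sum.
rewrite (@eq_Rintegral _ _ _ _ _
    (fun x => (g x) ^+ 2 + n%:R * \int[P]_x (g x) ^+ 2)); last first.
  move=> x _.
  rewrite (@eq_Rintegral _ _ _ _ _ (fun t : n.-tuple T =>
      ((g x) ^+ 2 + (2 * g x) * sample_sum g t) + (sample_sum g t) ^+ 2)); last first.
    by move=> t _; rewrite sample_sum_cons sqrrD -mulrA mulr_natl.
  have bc c : bounded_measurable (fun _ : n.-tuple T => c).
    exact: bounded_measurable_cst.
  have bcS : bounded_measurable (fun t : n.-tuple T => 2 * g x * sample_sum g t).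
    exact: bounded_measurableM.
  rewrite RintegralD//; last 2 first.
  - by apply: bounded_measurable_integrable; exact: bounded_measurableD.
  - exact: bounded_measurable_integrable.
  rewrite RintegralD//; [|exact: bounded_measurable_integrable..].
  rewrite RintegralZl//; last exact: bounded_measurable_integrable.
  by rewrite Rintegral_sample_sum// mulr0 addr0 IH Rintegral_probability_cst.
rewrite RintegralD//; last 2 first.
- exact: bounded_measurable_integrable.
- exact/bounded_measurable_integrable/bounded_measurable_cst.
by rewrite Rintegral_probability_cst -natr1 mulrDl mul1r addrC.
Qed.

(** The variance of the sample sum is [n] times that of one observation, at most
(2 M)^2.  The bound is the same for all [P], and the factor [n] on the left
makes the statement hold at n = 0. *)
Lemma chebyshev_sample_sum (f : T -> R) (M e : R) n :
  measurable_fun setT f -> (forall x, `|f x| <= M) -> 0 < e ->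
  n%:R * fine (power_probability P n
    [set x | n%:R * e <= `|sample_sum f x - n%:R * \int[P]_x f x|])
  <= 4 * M ^+ 2 / e ^+ 2.
Proof.
move=> mf fM e0; have bf : bounded_measurable f by split=> //; exists M.
have M0 : 0 <= M := le_trans (normr_ge0 _) (fM point).
case: n => [|n]; first by rewrite mul0r !mulr_ge0 ?invr_ge0 ?exprn_ge0// ltW.
set m := \int[P]_x f x; set N := n.+1; set A := [set x | _].
pose g x := f x - m.
have bg : bounded_measurable g.
  by apply: bounded_measurableD => //; exact: bounded_measurable_cst.
have g0 : \int[P]_x g x = 0.
  rewrite RintegralB//; last 2 first.
  - exact: bounded_measurable_integrable.
  - exact/bounded_measurable_integrable/bounded_measurable_cst.
  by rewrite Rintegral_probability_cst subrr.
have bn : bounded_measurable (fun x => `|f x|).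
  split; first exact: measurableT_comp.
  by exists M => x; rewrite normr_id.
have mM : `|m| <= M.
  apply: le_trans (le_normr_Rintegral _ _) _ => //.
    exact: bounded_measurable_integrable.
  rewrite -[leRHS](Rintegral_probability_cst P); apply: le_Rintegral => //.
  - exact: bounded_measurable_integrable.
  - exact/bounded_measurable_integrable/bounded_measurable_cst.
have gM x : (g x) ^+ 2 <= 4 * M ^+ 2.
  move: mM (fM x); rewrite /g !ler_norml; move: (f x) => y; nra.
pose S := @sample_sum g N.
have AE : A = [set x | N%:R * e <= `|S x|].
  apply/seteqP; rewrite /A/= /S /sample_sum /g.
  by split=> x /=; rewrite sumrB sumr_const card_ord -(mulr_natl m).
have bS : bounded_measurable S := bounded_measurable_sample_sum N bg.
have mA : measurable A.
  rewrite AE -[X in measurable X]setTI; apply: measurable_fun_le => //.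
  by apply: measurableT_comp => //; case: bS.
have : (N%:R * e) ^+ 2 * fine (power_probability P N A) <=
    \int[power_probability P N]_x (S x) ^+ 2.
  have bA := bounded_measurable_indic mA.
  rewrite -Rintegral_indic// -RintegralZl//; last exact: bounded_measurable_integrable.
  apply: le_Rintegral => //.
  - apply: bounded_measurable_integrable.
    by apply: bounded_measurableM => //; exact: bounded_measurable_cst.
  - by apply: bounded_measurable_integrable; exact: bounded_measurableM.
  - move=> x _; rewrite indicE; have [|_] := boolP (x \in A); last first.
      by rewrite mulr0 sqr_ge0.
    rewrite inE AE /= mulr1 => NS; rewrite -[leRHS]real_normK ?num_real//.
    by rewrite lerXn2r// nnegrE mulr_ge0// ltW.
rewrite Rintegral_sample_sum_sqr//.
have : \int[P]_x (g x) ^+ 2 <= 4 * M ^+ 2.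
  rewrite -[leRHS](Rintegral_probability_cst P); apply: le_Rintegral => //.
  - by apply: bounded_measurable_integrable; exact: bounded_measurableM.
  - exact/bounded_measurable_integrable/bounded_measurable_cst.
rewrite -(ler_pM2l (ltr0Sn R n)) => + /le_trans => /[swap] /[apply].
rewrite ler_pdivlMr ?exprn_gt0//; move: (fine _) => p.
rewrite exprMn expr2 -!mulrA ler_pM2l ?ltr0Sn//.
by rewrite [p * _]mulrC (expr2 e) -(mulrA e).
Qed.

End sample_sums.

(** * Pairs of families testable at rate 1/n *)

Section testable.
Context {d} {T : measurableType d} {R : realType}.
Implicit Types S : set (probability T R).

(** Errors of both kinds are at most c / n, uniformly on both families.  The
explicit rate tells how many tests a given sample size allows to combine. *)
Definition testable S0 S1 : Prop :=
  exists (A : forall n, set (n.-tuple T)) (c : R),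
    [/\ forall n, measurable (A n),
        forall n P, S0 P -> n%:R * fine (power_probability P n (A n)) <= c &
        forall n Q, S1 Q -> n%:R * fine (power_probability Q n (~` A n)) <= c].

Lemma testable_sub S0 S1 S0' S1' :
  S0 `<=` S0' -> S1 `<=` S1' -> testable S0' S1' -> testable S0 S1.
Proof.
move=> s0 s1 [A [c [mA A0 A1]]]; exists A, c.
by split=> [//|n P /s0/A0|n Q /s1/A1].
Qed.

Lemma testable_sym S0 S1 : testable S0 S1 -> testable S1 S0.
Proof.
move=> [A [c [mA A0 A1]]]; exists (fun n => ~` A n), c.
by split=> [n|//|n P P0]; [by apply: measurableC; exact: mA|rewrite setCK; exact: A0].
Qed.

Lemma testable0l S1 : testable set0 S1.
Proof.
exists (fun n => setT), 0; split => // n Q _.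
by rewrite setCT measure0 mulr0.
Qed.

(** Reject if one of the two tests rejects: the errors of the first kind add up,
and those of the second kind are those of the test designed for the
alternative at hand. *)
Lemma testableUr S0 S1 S2 :
  testable S0 S1 -> testable S0 S2 -> testable S0 (S1 `|` S2).
Proof.
move=> [A [a [mA A0 A1]]] [B [b [mB B0 B2]]].
have fle n (P : probability T R) (X Y : set (n.-tuple T)) : measurable X ->
    measurable Y -> X `<=` Y ->
    fine (power_probability P n X) <= fine (power_probability P n Y).
  by move=> mX mY XY; rewrite fine_le ?fin_num_measure// le_measure ?inE.
exists (fun n => A n `|` B n), (Num.max (a + b) (Num.max a b)); split=> [n|n P P0|n Q];
  have mAn := mA n; have mBn := mB n.
- exact: measurableU.
- rewrite le_max; apply/orP; left.
  apply: le_trans (lerD (A0 n P P0) (B0 n P P0)).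
  rewrite -mulrDr ler_wpM2l// -fineD ?fin_num_measure//.
  rewrite fine_le ?fin_numD ?fin_num_measure//; first exact: measurableU.
  exact: measureU2.
- have mC := measurableC (mA n); have mD := measurableC (mB n).
  have mCD := measurableI _ _ mC mD.
  rewrite setCU !le_max => -[Q1|Q2]; apply/orP; right; apply/orP.
    left; apply: le_trans (A1 n Q Q1); rewrite ler_wpM2l//.
    by apply: fle => //; exact: subIsetl.
  right; apply: le_trans (B2 n Q Q2); rewrite ler_wpM2l//.
  by apply: fle => //; exact: subIsetr.
Qed.

Lemma testableUl S0 S1 S2 :
  testable S0 S2 -> testable S1 S2 -> testable (S0 `|` S1) S2.
Proof.
by move=> /testable_sym S02 /testable_sym S12; exact/testable_sym/testableUr.
Qed.

(** Reject when the sample mean of [f] is at distance at least 3e/4 from [a].  On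
either side an error forces it to be at distance at least e/4 from the true
mean. *)
Lemma testable_mean (f : T -> R) (a e : R) : bounded_measurable f -> 0 < e ->
  testable [set P | `|\int[P]_x f x - a| < e / 2]
           [set Q | e <= `|\int[Q]_x f x - a|].
Proof.
move=> [mf [M fM]] e0; have e40 : 0 < e / 4 by lra.
have mS n b c : measurable
    [set x : n.-tuple T | c <= `|sample_sum f x - n%:R * b|].
  rewrite -[X in measurable X]setTI; apply: measurable_fun_le => //.
  apply: measurableT_comp => //; apply: measurable_funB => //.
  have [//] : bounded_measurable (@sample_sum _ T R f n).
  by apply: bounded_measurable_sample_sum; split => //; exists M.
exists (fun n => [set x | n%:R * (3 / 4 * e) <= `|sample_sum f x - n%:R * a|]).
exists (4 * M ^+ 2 / (e / 4) ^+ 2).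
have cheb n (P : probability T R) (A : set (n.-tuple T)) : measurable A ->
    (forall x, A x -> n%:R * (e / 4) <= `|sample_sum f x - n%:R * \int[P]_x f x|) ->
    n%:R * fine (power_probability P n A) <= 4 * M ^+ 2 / (e / 4) ^+ 2.
  move=> mA Ae; apply: le_trans (chebyshev_sample_sum P n mf fM e40).
  have mB := mS n (\int[P]_x f x) (n%:R * (e / 4)).
  by rewrite ler_wpM2l// fine_le ?fin_num_measure// le_measure ?inE.
split=> [n|n P /= Pa|n Q /= Qa]; first exact: mS.
- apply: cheb => // x /= xa.
  have : n%:R * `|\int[P]_x f x - a| <= n%:R * (e / 2).
    by rewrite ler_wpM2l// ltW.
  have -> : n%:R * `|\int[P]_x f x - a| = `|n%:R * \int[P]_x f x - n%:R * a|.
    by rewrite -mulrBr normrM [ `|n%:R|]ger0_norm.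
  have := ler_distD (n%:R * \int[P]_x f x) (sample_sum f x) (n%:R * a).
  lra.
- apply: cheb => [|x /negP]; first by apply: measurableC; exact: mS.
  rewrite -ltNge => xa.
  have : n%:R * e <= n%:R * `|\int[Q]_x f x - a| by rewrite ler_wpM2l.
  have -> : n%:R * `|\int[Q]_x f x - a| = `|n%:R * \int[Q]_x f x - n%:R * a|.
    by rewrite -mulrBr normrM [ `|n%:R|]ger0_norm.
  have := ler_distD (sample_sum f x) (n%:R * \int[Q]_x f x) (n%:R * a).
  rewrite (distrC (n%:R * _) (sample_sum f x)); lra.
Qed.

End testable.

Section testable_topology.
Context {Omega : ptopologicalType} {R : realType} (Psi : set (Omega -> R)).
Hypothesis PsiB : forall f, Psi f -> bounded_measurable (f : borel Omega -> R).

(** The sets V whose complement is separable from some neighbourhood of [P] form a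
filter.  By [testable_mean] this filter converges to [P] in each of the initial
topologies generating [tau Psi], hence in [tau Psi] itself; in particular it
contains the open set ~` D. *)
Lemma testable_near (D : set (tau Psi)) (P : tau Psi) : closed D -> ~ D P ->
  exists2 U, nbhs P U & testable (U : set (probability (borel Omega) R)) D.
Proof.
move=> cD nDP.
pose G : set_system (tau Psi) := [set V | exists2 U, nbhs P U &
  testable (U : set (probability (borel Omega) R)) (~` V)].
have FG : Filter G.
  split.
  - by exists setT; [exact: filterT|rewrite setCT; exact/testable_sym/testable0l].
  - move=> V W [U PU UV] [U' PU' UW]; exists (U `&` U'); first exact: filterI.
    rewrite setCI; apply: testableUr.
      by apply: testable_sub UV => //; exact: subIsetl.
    by apply: testable_sub UW => //; exact: subIsetr.
  - move=> V W VW [U PU UV]; exists U => //; apply: testable_sub UV => //.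
    exact: subsetC.
suff : G --> P.
  move=> GP; have [|U PU] := GP (~` D).
    by apply: open_nbhs_nbhs; split=> //; exact: closed_openC.
  by rewrite setCK; exists U.
apply/cvg_sup => -[f Pf] W /=.
rewrite (@nbhsE (initial_topology
  (fun Q : prob_measures Omega R => \int[Q]_x f x : R))).
move=> [V [[B oB <-] BP] VW].
have /nbhs_ballP[e /= e0 eB] : nbhs (\int[P]_x f x : R) B by exact: open_nbhs_nbhs.
exists [set Q : prob_measures Omega R |
    `|\int[Q]_x f x - \int[P]_x f x| < e / 2].
  have : nbhs (\int[P]_x f x) [set y | `|y - \int[P]_x f x| < e / 2].
    by apply/nbhs_ballP; exists (e / 2) => /= [|y]; rewrite ?divr_gt0// /ball/= distrC.
  exact: (continuous_tau Pf).
apply: testable_sub (testable_mean (\int[P]_x f x) (PsiB Pf) e0) => // Q /= nWQ.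
rewrite leNgt; apply/negP => Qe; apply: nWQ; apply: VW; apply: eB.
by rewrite /ball/= distrC.
Qed.

Lemma testable_compact_closed (C D : set (tau Psi)) : compact C -> closed D ->
  C `&` D = set0 -> testable (C : set (probability (borel Omega) R)) D.
Proof.
move=> cC cD CD0.
apply: (@compact_local_ind (tau Psi)
  (fun A => testable (A : set (probability (borel Omega) R)) D)) cC _.
- exact: testable0l.
- by move=> A B AB; exact: testable_sub.
- by move=> A B; exact: testableUl.
- move=> P CP; apply: testable_near => // DP.
  by have : (C `&` D) P by []; rewrite CD0.
Qed.

End testable_topology.

(** * Combining countably many alternatives *)

(** With error bounds c_k / n for the k-th alternative, the k-th test is used at
sample size n > k once c_k / sqrt n <= 2^-(k+1).  The errors of the first
kind then sum to at most sum_k 2^-(k+1) / sqrt n <= 1 / sqrt n, and each test is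
eventually used. *)
Lemma consistent_regions_diagonal (Omega : ptopologicalType) (R : realType)
    (Theta0 Theta1 : set (prob_measures Omega R))
    (D : (set (prob_measures Omega R))^nat) :
  (forall k, testable (Theta0 : set (probability (borel Omega) R)) (D k)) ->
  Theta1 `<=` \bigcup_k D k -> exists A, consistent_regions Theta0 Theta1 A.
Proof.
move=> /choice[A /choice[c Ac]] TD.
(* chosen so that c k / n = (c k * r n) * r n *)
pose r n : R := Num.sqrt n%:R^-1.
have r0 : r n @[n --> \oo] --> 0.
  rewrite -cvg_shiftS; have sc := @sqrt_continuous R 0.
  rewrite /continuous_at sqrtr0 in sc.
  exact: (cvg_comp _ _ cvg_harmonic sc).
have rr n : n%:R^-1 = r n * r n by rewrite -expr2 sqr_sqrtr.
pose w k : R := 2 ^- k.+1.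
have w0 k : 0 < w k by rewrite invr_gt0 exprn_gt0.
pose B n k : set (n.-tuple (borel Omega)) :=
  if c k * r n <= w k then A k n else set0.
have mB n k : measurable (B n k).
  by rewrite /B; case: ifP => // _; case: (Ac k).
have mBn n : measurable (\big[setU/set0]_(k < n) B n k).
  by apply: bigsetU_measurable => k _; exact: mB.
exists (fun n => \big[setU/set0]_(k < n) B n k); split.
- exact: mBn.
- exists r => // n P P0.
  case: n => [|n]; first by rewrite big_ord0 measure0 sqrtr_ge0.
  apply: (@le_trans _ _ (\sum_(k < n.+1) w k * r n.+1)); last first.
    rewrite -mulr_suml ler_piMl ?sqrtr_ge0//.
    suff -> m : \sum_(k < m) w k = 1 - 2 ^- m by rewrite lerBlDr lerDl invr_ge0 exprn_ge0.
    elim: m => [|m IH]; first by rewrite big_ord0 expr0 invr1 subrr.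
    by rewrite big_ord_recr /= IH /w exprS invfM; lra.
  have mBn1 := mBn n.+1; rewrite -lee_fin fineK ?fin_num_measure//.
  apply: le_trans (Boole_inequality _ _) _ => [k _|]; first exact: mB.
  rewrite -sumEFin; apply: lee_sum => k _.
  rewrite /B; case: ifP => [ck|_]; last first.
    by rewrite measure0 lee_fin mulr_ge0 ?sqrtr_ge0 ?(ltW (w0 _)).
  have [mA A0 _] := Ac k; have mAn := mA n.+1.
  rewrite -[leLHS]fineK ?fin_num_measure// lee_fin.
  rewrite (le_trans _ (ler_wpM2r _ ck)) ?sqrtr_ge0//.
  rewrite -mulrA -rr ler_pdivlMr// mulrC; exact: A0.
- move=> Q Q1; have [k _ DQ] := TD Q Q1.
have [mA _ A1] := Ac k.
apply: (@squeeze_cvgr _ _ _ _ (cst 0) (fun n => w k * r n)).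
- near=> n.
  have ck : c k * r n <= w k.
    near: n; have : c k * r n @[n --> \oo] --> c k * 0.
      by apply: cvgM => //; exact: cvg_cst.
    by rewrite mulr0 => /cvgr_le; apply.
  have kn : (k < n)%N by near: n; exact: nbhs_infty_gt.
  have mAn := mA n; have mBn' := mBn n.
  rewrite fine_ge0//=; apply: (@le_trans _ _ (c k / n%:R)).
    rewrite ler_pdivlMr ?ltr0n ?(leq_ltn_trans _ kn)// mulrC.
    apply: le_trans (A1 n Q DQ); rewrite ler_wpM2l//.
    have mAc := measurableC (mA n); have mBc := measurableC (mBn n).
    rewrite fine_le ?fin_num_measure// le_measure ?inE//.
    apply: subsetC; rewrite -bigcup_mkord => x Akx; exists k => //.
    by rewrite /B ck.
  by rewrite rr mulrA ler_wpM2r ?sqrtr_ge0.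
- exact: cvg_cst.
- by rewrite -[X in _ --> X](mulr0 (w k)); apply: cvgM => //; exact: cvg_cst.
Unshelve. all: by end_near. Qed.

(** * Generators of the three topologies *)

Lemma bounded_fun_le (T : Type) (R : realType) (f : T -> R) :
  bounded_fun f -> exists M, forall x, `|f x| <= M.
Proof.
move=> [M [_ fM]]; exists (M + 1) => x.
by apply: (fM (M + 1)) => //; rewrite ltrDl.
Qed.

Lemma continuous_borel_measurable (Omega : ptopologicalType) (R : realType)
    (f : Omega -> R) : continuous f -> measurable_fun setT (f : borel Omega -> R).
Proof.
move=> /continuousP cf; apply: (measurability _ (RGenOpens.measurableE R)).
move=> _ [_ [a [b ->]] <-]; rewrite setTI; apply: sub_sigma_algebra.
exact/cf/interval_open.
Qed.

(** The weak, tau- and tau_Phi-topologies are all generated by bounded Borel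
functions, which is all that the construction of tests needs. *)
Lemma bounded_measurable_tau_generators (Omega : ptopologicalType)
    (R : realType) (Psi : set (Omega -> R)) :
  [\/ Psi = bounded_continuous, Psi = borel_indicators | Psi = bounded_borel] ->
  forall f, Psi f -> bounded_measurable (f : borel Omega -> R).
Proof.
move=> [->|->|->] f.
- move=> [cf /bounded_fun_le bf]; split => //.
  exact: continuous_borel_measurable.
- by move=> [A mA <-]; exact: bounded_measurable_indic.
- by move=> [mf /bounded_fun_le bf].
Qed.

Theorem theorem4p3 (R : realType) (Omega : ptopologicalType)
    (Theta0 Theta1 : set (prob_measures Omega R)) :
  (forall Psi : set (Omega -> R),
      [\/ Psi = bounded_continuous, Psi = borel_indicators
        | Psi = bounded_borel] ->
      @precompact (tau Psi) Theta0 ->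
      closed_Fsigma_separated Psi Theta0 Theta1 ->
      has_consistent_tests Theta0 Theta1)
  /\
  (@precompact (tau borel_indicators) Theta0 ->
   (exists2 S : set (tau borel_indicators),
      sigma_compact S & Theta1 `<=` S) ->
   has_consistent_tests Theta0 Theta1 ->
   closed_Fsigma_separated borel_indicators Theta0 Theta1).
Proof.
split=> [Psi PsiE|pc0 sc1 /has_consistent_testsP[A cA]]; last first.
  exact: consistent_regions_separated cA pc0 sc1.
have PsiB := bounded_measurable_tau_generators PsiE.
rewrite precompactE => c0 [F0 [F1 [cF0 [D cD F1E] T0 T1 F01]]].
apply/has_consistent_testsP; apply: (@consistent_regions_diagonal _ _ _ _ D).
  move=> k.
  apply: (@testable_sub _ _ _ _ _ (closure (Theta0 : set (tau Psi))) (D k)) => //.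
    exact: (@subset_closure (tau Psi) Theta0).
  apply: testable_compact_closed => //; rewrite -subset0 -F01 => P [P0 DP].
  split; last by rewrite F1E; exists k.
  have /closure_id -> := cF0; exact: closureS P0.
by rewrite -F1E.
Qed.
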